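(* Let $M$ be an orientable Riemannian four-manifold and let $N$ be a totally umbilical hypersurface of $M$ with constant mean curvature. Let $\phi:\Sigma\to N$ be an isometric immersion of an orientable Riemannian surface $\Sigma$ with constant mean curvature in $N$. Then $\phi$, regarded as an immersion of $\Sigma$ into $M$, is either a parallel mean curvature immersion or a minimal immersion.
   Context: For an isometric immersion of a $k$-dimensional Riemannian manifold $S$ into a Riemannian manifold $Q$ with Levi-Civita connection $\overline\nabla$, let $\sigma$ be the second fundamental form (normal-bundle valued, $\sigma(X,Y)=(\overline\nabla_XY)^\perp$) and $H=\frac1k\operatorname{trace}\sigma$ the mean curvature vector. The normal connection is $\nabla^\perp_X\eta=(\overline\nabla_X\eta)^\perp$ for $X$ tangent and $\eta$ normal. The immersion is minimal if $H\equiv 0$. A hypersurface, or a surface in a three-manifold, has constant mean curvature if its mean curvature vector has constant length (possibly zero). A hypersurface $N\subset M$ with second fundamental form $\widehat\sigma$ and mean curvature vector $\widehat H$ is totally umbilical if $\widehat\sigma(x,y)=\langle x,y\rangle\widehat H$ for all $x,y$ tangent to $N$ at the same point. An isometric immersion of a surface $\Sigma$ into $M$ has parallel mean curvature if its mean curvature vector $H$ satisfies $\nabla^\perp H=0$ and $H$ is not identically zero. *)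

(* Defs.v *)
From HB Require Import structures.
From mathcomp Require Import all_boot all_order all_algebra.
From mathcomp Require Import all_classical all_reals all_analysis.
From mathcomp Require Import ring lra.

Set Implicit Arguments.
Unset Strict Implicit.
Unset Printing Implicit Defensive.

Import Order.TTheory GRing.Theory Num.Theory.
Import numFieldNormedType.Exports.
Local Open Scope classical_set_scope.
Local Open Scope ring_scope.

(* C^k on an open set of a finite-dimensional space: Fréchet differentiable,
   with every directional derivative of class C^(k-1). *)
Fixpoint Ck_on (R : realType) (V W : normedModType R) (k : nat)
    (U : set V) (f : V -> W) : Prop :=
  if k is k'.+1 then
    (forall x, U x -> differentiable f x) /\
    (forall v, Ck_on k' U (fun x => 'D_v f x))
  else forall x, U x -> {for x, continuous f}.

Definition smooth_on (R : realType) (V W : normedModType R)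
    (U : set V) (f : V -> W) : Prop :=
  forall k, Ck_on k U f.

(* [cmap] and [cinv] are total functions; their values outside [cdom] and
   [cimg] are irrelevant. *)
Record chart (R : realType) (n : nat) (T : topologicalType) : Type := Chart {
  cdom : set T;
  cimg : set 'rV[R]_n;
  cmap : T -> 'rV[R]_n;
  cinv : 'rV[R]_n -> T;
  cdom_open : open cdom;
  cimg_open : open cimg;
  cmap_img : forall p, cdom p -> cimg (cmap p);
  cinv_dom : forall y, cimg y -> cdom (cinv y);
  cmapK : forall p, cdom p -> cinv (cmap p) = p;
  cinvK : forall y, cimg y -> cmap (cinv y) = y;
  cmap_continuous : forall p, cdom p -> {for p, continuous cmap};
  cinv_continuous : forall y, cimg y -> {for y, continuous cinv} }.

(* The coordinate expression of a map in two charts, and its domain. For the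
   identity map this is the transition function from [c] to [d]. *)
Definition loc_dom (R : realType) (k n : nat) (S T : topologicalType)
    (f : S -> T) (c : chart R k S) (d : chart R n T) : set 'rV[R]_k :=
  [set y | cimg c y /\ cdom d (f (cinv c y))].

Definition loc (R : realType) (k n : nat) (S T : topologicalType)
    (f : S -> T) (c : chart R k S) (d : chart R n T) : 'rV[R]_k -> 'rV[R]_n :=
  fun y => cmap d (f (cinv c y)).

Definition compatible (R : realType) (n : nat) (T : topologicalType)
    (c d : chart R n T) : Prop :=
  smooth_on (loc_dom idfun c d) (loc idfun c d) /\
  smooth_on (loc_dom idfun d c) (loc idfun d c).

Record manifold (R : realType) (n : nat) : Type := Manifold {
  carrier :> topologicalType;
  atlas : set (chart R n carrier);
  manifold_hausdorff : hausdorff_space carrier;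
  manifold_second_countable : @second_countable carrier;
  atlas_cover : forall p, exists2 c, atlas c & cdom c p;
  atlas_compatible : forall c d, atlas c -> atlas d -> compatible c d;
  atlas_maximal : forall c,
    (forall d, atlas d -> compatible c d) -> atlas c }.
Arguments atlas {R n} m.

(* Vectors are rows, so the Jacobian of a transition function acts on the
   right ([deriveEjacobian]). *)
Definition orientable (R : realType) (n : nat) (M : manifold R n) : Prop :=
  exists A : set (chart R n M),
    [/\ A `<=` atlas M,
        forall p : M, exists2 c, A c & cdom c p
      & forall c d, A c -> A d -> forall y, loc_dom idfun c d y ->
          0 < \det ('J (loc idfun c d) y)].

Definition smooth_map (R : realType) (k n : nat) (S : manifold R k)
    (T : manifold R n) (f : S -> T) : Prop :=
  continuous f /\
  forall c d, atlas S c -> atlas T d -> smooth_on (loc_dom f c d) (loc f c d).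

Definition bilin (R : realType) (n : nat) (g : 'M[R]_n) (v w : 'rV[R]_n) : R :=
  (v *m g *m w^T) 0 0.

(* [metric c y] is the Gram matrix, in the chart [c], of the metric at the point
   of coordinates [y]; [metric_transition] says that these matrices are the
   expressions of a single tensor on the manifold. *)
Record riemannian (R : realType) (n : nat) : Type := Riemannian {
  space :> manifold R n;
  metric : chart R n space -> 'rV[R]_n -> 'M[R]_n;
  metric_smooth : forall c, atlas space c -> smooth_on (cimg c) (metric c);
  metric_sym : forall c y, atlas space c -> cimg c y ->
    (metric c y)^T = metric c y;
  metric_pos : forall c y v, atlas space c -> cimg c y -> v != 0 ->
    0 < bilin (metric c y) v v;
  metric_transition : forall c d y, atlas space c -> atlas space d ->
    loc_dom idfun c d y ->
    let J := 'J (loc idfun c d) y in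
    metric c y = J *m metric d (loc idfun c d y) *m J^T }.
Arguments metric {R n} r c y.

(* The covector u |-> <nabla_v w, u> given by the Koszul formula for constant
   (hence commuting) local fields v, w, u. *)
Definition koszul (R : realType) (n : nat) (g : 'rV[R]_n -> 'M[R]_n)
    (y v w u : 'rV[R]_n) : R :=
  2^-1 * (bilin ('D_v g y) w u + bilin ('D_w g y) v u - bilin ('D_u g y) v w).

(* Gamma^l_ij v^i w^j, where the Gamma^l_ij are the Christoffel symbols of the
   Levi-Civita connection of [g]; see [christoffel_torsion_free],
   [christoffel_metric] and [christoffel_unique]. *)
Definition christoffel (R : realType) (n : nat) (g : 'rV[R]_n -> 'M[R]_n)
    (y v w : 'rV[R]_n) : 'rV[R]_n :=
  (\row_l koszul g y v w (delta_mx 0 l)) *m invmx (g y).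

(* The orthogonal projections of [xi], for the inner product [g], onto the row
   space of [J] and onto its orthogonal complement. *)
Definition tangent_part (R : realType) (k n : nat) (g : 'M[R]_n)
    (J : 'M[R]_(k, n)) (xi : 'rV[R]_n) : 'rV[R]_n :=
  xi *m g *m J^T *m invmx (J *m g *m J^T) *m J.

Definition normal_part (R : realType) (k n : nat) (g : 'M[R]_n)
    (J : 'M[R]_(k, n)) (xi : 'rV[R]_n) : 'rV[R]_n :=
  xi - tangent_part g J xi.

Lemma bilinC (R : realType) (n : nat) (A : 'M[R]_n) v w :
  A^T = A -> bilin A v w = bilin A w v.
Proof.
move=> sA; rewrite /bilin -[in RHS]sA.
transitivity ((v *m A *m w^T)^T 0 0); first by rewrite [RHS]mxE.
by rewrite !trmx_mul trmxK mulmxA.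
Qed.

Lemma bilin_sum (R : realType) (n : nat) (A : 'M[R]_n) v w :
  bilin A v w = \sum_l w 0 l * bilin A v (delta_mx 0 l).
Proof.
rewrite /bilin mxE; apply: eq_bigr => l _.
by rewrite trmx_delta -colE !mxE mulrC.
Qed.

Lemma koszul_sum (R : realType) (n : nat) (A B : 'M[R]_n)
    (D : 'I_n -> 'M[R]_n) v w u :
  2^-1 * (bilin A w u + bilin B v u - bilin (\sum_l u 0 l *: D l) v w) =
  \sum_l 2^-1 * (bilin A w (delta_mx 0 l) + bilin B v (delta_mx 0 l)
                 - bilin (D l) v w) * u 0 l.
Proof.
have -> : bilin (\sum_l u 0 l *: D l) v w = \sum_l u 0 l * bilin (D l) v w.
  rewrite /bilin mulmx_sumr mulmx_suml summxE; apply: eq_bigr => l _.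
  by rewrite -scalemxAr -scalemxAl mxE.
rewrite (bilin_sum A) (bilin_sum B) -big_split -sumrB mulr_sumr.
by apply: eq_bigr => l _ /=; ring.
Qed.

Lemma bilin_inj (R : realType) (n : nat) (A : 'M[R]_n) v w :
  A \in unitmx -> (forall u, bilin A v u = bilin A w u) -> v = w.
Proof.
move=> Au vw; apply: (can_inj (mulmxK Au)); apply/rowP => l.
have := vw (delta_mx 0 l); rewrite /bilin trmx_delta -!colE.
by rewrite !mxE.
Qed.

Section LeviCivita.
Variables (R : realType) (n : nat) (g : 'rV[R]_n -> 'M[R]_n) (y : 'rV[R]_n).
Hypothesis g_diff : differentiable g y.
Hypothesis g_sym : \forall z \near y, (g z)^T = g z.
Hypothesis g_unit : g y \in unitmx.

Lemma derive_gram_sym v : ('D_v g y)^T = 'D_v g y.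
Proof.
have dg : derivable g y v by exact: diff_derivable.
apply/matrixP => i j; rewrite derive_mx // !mxE.
apply: near_eq_derive; near=> z.
by rewrite -[in LHS](near g_sym z) ?mxE.
Unshelve. all: by end_near. Qed.

Lemma derive_gram_sum v : 'D_v g y = \sum_l v 0 l *: 'D_(delta_mx 0 l) g y.
Proof.
rewrite {1}(row_sum_delta v) !deriveE // linear_sum; apply: eq_bigr => l _.
by rewrite linearZ deriveE.
Qed.

Lemma bilin_christoffel v w u :
  bilin (g y) (christoffel g y v w) u = koszul g y v w u.
Proof.
rewrite /bilin /christoffel mulmxKV // /koszul (derive_gram_sum u).
rewrite koszul_sum mxE; apply: eq_bigr => l _.
by rewrite [X in X * _]mxE [X in _ * X]mxE.
Qed.

Lemma christoffel_torsion_free v w :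
  christoffel g y v w = christoffel g y w v.
Proof.
congr (_ *m _); apply/rowP => l; rewrite !mxE /koszul.
by rewrite (bilinC v w (derive_gram_sym _)) [in X in X - _]addrC.
Qed.

Lemma christoffel_metric u v w :
  bilin ('D_u g y) v w =
  bilin (g y) (christoffel g y u v) w + bilin (g y) v (christoffel g y u w).
Proof.
have E (a b c : R) : a = 2^-1 * (a + b - c) + 2^-1 * (a + c - b) by field.
rewrite (bilinC v _ (nbhs_singleton g_sym)) !bilin_christoffel /koszul.
by rewrite (bilinC w v (derive_gram_sym u)); exact: E.
Qed.

Lemma christoffel_unique (B : 'rV[R]_n -> 'rV[R]_n -> 'rV[R]_n) :
  (forall v w, B v w = B w v) ->
  (forall u v w,
    bilin ('D_u g y) v w = bilin (g y) (B u v) w + bilin (g y) v (B u w)) ->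
  forall v w, B v w = christoffel g y v w.
Proof.
move=> BC Bg v w; apply: (bilin_inj g_unit) => u.
have gC := bilinC _ _ (nbhs_singleton g_sym).
have E (a b c : R) : a = 2^-1 * (a + b + (c + a) - (b + c)) by field.
rewrite bilin_christoffel /koszul.
rewrite (Bg v w u) (Bg w v u) (Bg u v w) (BC w v) (BC u v) (BC u w).
by rewrite (gC w (B v u)) [X in _ + X - _]addrC (gC v (B w u)); exact: E.
Qed.

End LeviCivita.

Lemma normal_part_orthogonal (R : realType) (k n : nat) (g : 'M[R]_n)
    (J : 'M[R]_(k, n)) (xi : 'rV[R]_n) (v : 'rV[R]_k) :
  J *m g *m J^T \in unitmx -> bilin g (normal_part g J xi) (v *m J) = 0.
Proof.
move=> Ju; rewrite /bilin /normal_part /tangent_part trmx_mul mulmxA.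
have -> : (xi - xi *m g *m J^T *m invmx (J *m g *m J^T) *m J) *m g *m J^T =
          xi *m g *m J^T - xi *m g *m J^T *m invmx (J *m g *m J^T) *m
                           (J *m g *m J^T) by rewrite !mulmxBl !mulmxA.
by rewrite mulmxKV // subrr mul0mx mxE.
Qed.

Section Immersions.
Variables (R : realType) (k n : nat) (S : riemannian R k) (Q : riemannian R n).
Variable f : S -> Q.

Definition isometric_immersion : Prop :=
  smooth_map f /\
  forall c d, atlas S c -> atlas Q d -> forall y, loc_dom f c d y ->
    let J := 'J (loc f c d) y in
    row_free J /\ metric S c y = J *m metric Q d (loc f c d y) *m J^T.

(* In this section vector fields are written in charts [c] of [S] and [d] of
   [Q]: a field tangent to [S] is a map ['rV_k -> 'rV_k], a field of [Q] along
   [f] is a map ['rV_k -> 'rV_n]. *)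
Section InCharts.
Variables (c : chart R k S) (d : chart R n Q).

Definition pushforward (Y : 'rV[R]_k -> 'rV[R]_k) (y : 'rV[R]_k) : 'rV[R]_n :=
  Y y *m 'J (loc f c d) y.

(* The Levi-Civita connection of [Q] along [f]: nabla_X eta. *)
Definition cov_deriv (X : 'rV[R]_k -> 'rV[R]_k) (eta : 'rV[R]_k -> 'rV[R]_n)
    (y : 'rV[R]_k) : 'rV[R]_n :=
  'D_(X y) eta y +
  christoffel (metric Q d) (loc f c d y) (pushforward X y) (eta y).

Definition normal_proj (y : 'rV[R]_k) (xi : 'rV[R]_n) : 'rV[R]_n :=
  normal_part (metric Q d (loc f c d y)) ('J (loc f c d) y) xi.

(* (nabla_X Y)^perp; its value at [y] depends only on X y and Y y, so it is
   evaluated below on fields with constant components. *)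
Definition second_form (X Y : 'rV[R]_k -> 'rV[R]_k) (y : 'rV[R]_k)
    : 'rV[R]_n :=
  normal_proj y (cov_deriv X (pushforward Y) y).

(* The trace is the contraction with the inverse g^ij of the metric of [S]. *)
Definition mean_curvature (y : 'rV[R]_k) : 'rV[R]_n :=
  k%:R^-1 *: \sum_i \sum_j
    invmx (metric S c y) i j *:
      second_form (cst (delta_mx 0 i)) (cst (delta_mx 0 j)) y.

Definition normal_conn (X : 'rV[R]_k -> 'rV[R]_k) (eta : 'rV[R]_k -> 'rV[R]_n)
    (y : 'rV[R]_k) : 'rV[R]_n :=
  normal_proj y (cov_deriv X eta y).

End InCharts.

Definition zero_mean_curvature : Prop :=
  forall c d, atlas S c -> atlas Q d -> forall y, loc_dom f c d y ->
    mean_curvature c d y = 0.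

Definition minimal_immersion : Prop :=
  isometric_immersion /\ zero_mean_curvature.

Definition constant_mean_curvature : Prop :=
  exists h : R,
    forall c d, atlas S c -> atlas Q d -> forall y, loc_dom f c d y ->
      let H := mean_curvature c d y in
      Num.sqrt (bilin (metric Q d (loc f c d y)) H H) = h.

Definition totally_umbilical : Prop :=
  forall c d, atlas S c -> atlas Q d -> forall y, loc_dom f c d y ->
    forall v w : 'rV[R]_k,
      second_form c d (cst v) (cst w) y =
      bilin (metric S c y) v w *: mean_curvature c d y.

Definition parallel_mean_curvature_immersion : Prop :=
  [/\ isometric_immersion,
      forall c d, atlas S c -> atlas Q d -> forall y, loc_dom f c d y ->
        forall v : 'rV[R]_k,
          normal_conn c d (cst v) (mean_curvature c d) y = 0
    & ~ zero_mean_curvature].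

End Immersions.

(* Main.v *)
From HB Require Import structures.
Require Import Defs.
From mathcomp Require Import all_boot all_order all_algebra.
From mathcomp Require Import all_classical all_reals all_analysis.
From mathcomp Require Import ring lra.

(* Write [F] for [iota], [f] for [phi], [Hhat] for the mean curvature vector of
   [N] in [M] and [H_f] for that of [Sigma] in [N]. As [N] is umbilical, the
   Gauss formula gives nabla_X (dF xi) = dF (nabla_X xi) + <X, xi> Hhat for [xi]
   tangent to [N]; taking the trace, the mean curvature vector of the composite
   is dF H_f + Hhat. A normal field of constant length along a hypersurface is
   parallel, because the normal spaces are lines. For H_f this gives
   (nabla_X H_f)^perp = 0 in [N], hence also for dF H_f in [M], where the extra
   term <X, H_f> Hhat vanishes. For Hhat it gives that nabla_X Hhat is tangent
   to [N]; by umbilicity it is - |Hhat|^2 dF X, which is tangent to [Sigma]. So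
   the composite always has parallel mean curvature vector, and it is minimal
   exactly when this vector vanishes identically. *)

Set Implicit Arguments.
Unset Strict Implicit.
Unset Printing Implicit Defensive.

Import Order.TTheory GRing.Theory Num.Theory.
Import numFieldNormedType.Exports.
Local Open Scope classical_set_scope.
Local Open Scope ring_scope.

(** * Differential calculus *)

Section Differentiability.
Context {R : realType}.

(** Near [x] both maps have the same first-order expansion, so ['d f x] also serves as the
    differential of [g]. This matters because coordinate formulas hold only inside chart domains. *)
Lemma near_eq_differentiable (V W : normedModType R) (f g : V -> W) (x : V) :
  (\near x, f x = g x) -> differentiable f x -> differentiable g x.
Proof.
move=> fg df; have fgx : f x = g x := nbhs_singleton fg.
have dg : g \o shift x = cst (g x) + 'd f x +o_ 0 id.
  apply/eqaddoP => e e0.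
  have /eqaddoP /(_ _ e0) := diff_locally df.
  have : \forall h \near (0 : V), f (h + x) = g (h + x).
    by move: fg; rewrite (near_shift 0); apply: filterS => h /=; rewrite subr0.
  by apply: filterS2 => h fgh; rewrite !fctE /= fgh fgx.
apply/diff_locallyP; rewrite (diff_unique (diff_continuous df) dg).
by split=> //; exact: diff_continuous.
Qed.

Lemma differentiable_mxP (V : normedModType R) m n (A : V -> 'M[R]_(m, n)) x :
  differentiable A x <-> forall i j, differentiable (fun z => A z i j) x.
Proof.
split=> [dA i j|dA].
  exact: (differentiable_comp dA (@differentiable_coord _ _ _ _ i j)).
have -> : A = \sum_i \sum_j ((fun z => A z i j *: delta_mx i j)).
  apply/funext => z; rewrite [LHS]matrix_sum_delta fct_sumE.
  by apply: eq_bigr => i _; rewrite fct_sumE.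
by do 2![apply: differentiable_sum => ?]; exact: differentiableZl.
Qed.

Lemma differentiable_bigsum (V W : normedModType R) (I : finType)
    (A : I -> V -> W) x :
  (forall i, differentiable (A i) x) ->
  differentiable (fun z => \sum_i A i z) x.
Proof.
move=> dA; have -> : (fun z => \sum_i A i z) = \sum_i A i.
  by apply/funext => z; rewrite fct_sumE.
elim/big_ind : _ => [|g h dg dh|//]; first exact: differentiable_cst.
exact: differentiableD.
Qed.

Lemma derive_bigsum (V W : normedModType R) (I : finType)
    (A : I -> V -> W) x v :
  (forall i, differentiable (A i) x) ->
  'D_v (fun z => \sum_i A i z) x = \sum_i 'D_v (A i) x.
Proof.
move=> dA; have -> : (fun z => \sum_i A i z) = \sum_i A i.
  by apply/funext => z; rewrite fct_sumE.
suff [] : differentiable (\sum_i A i) x /\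
  'D_v (\sum_i A i) x = \sum_i 'D_v (A i) x by [].
elim/big_ind2 : _ => [|f f' g g' [df <-] [dg <-]|i _]; last by [].
  by split; [exact: differentiable_cst|exact: derive_cst].
by split; [exact: differentiableD|rewrite deriveD //; exact: diff_derivable].
Qed.

Lemma differentiable_bigprod (V : normedModType R) (I : finType)
    (a : I -> V -> R) x :
  (forall i, differentiable (a i) x) ->
  differentiable (fun z => \prod_i a i z) x.
Proof.
move=> da; suff H (s : seq I) : differentiable (fun z => \prod_(i <- s) a i z) x.
  exact: H.
elim: s => [|i s IH].
  have -> : (fun z => \prod_(i <- [::]) a i z) = cst 1.
    by apply/funext => z; rewrite big_nil.
  exact: differentiable_cst.
have -> : (fun z => \prod_(j <- i :: s) a j z) =
          a i * (fun z => \prod_(j <- s) a j z).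
  by apply/funext => z; rewrite big_cons.
exact: differentiableM.
Qed.

(** Scaling is a continuous bilinear map, packed as such in the proof; the formula is its
    differential composed with that of the pair [(a, A)]. *)
Lemma is_diff_scale (V W : normedModType R) (a : V -> R) (A : V -> W) x :
  differentiable a x -> differentiable A x ->
  is_diff x (fun z => a z *: A z) (fun v => a x *: 'd A x v + 'd a x v *: A x).
Proof.
move=> da dA.
have bil : bilinear_for (GRing.Scale.Law.clone _ _ *:%R _)
    (GRing.Scale.Law.clone _ _ *:%R _) (@GRing.scale R W).
  split=> [u'|u] b y z /=; first by rewrite scalerDl scalerA.
  by rewrite scalerDr !scalerA mulrC.
pose m := bilinear_isBilinear.Build R R W W _ _ (@GRing.scale R W) bil.
pose F : {bilinear R -> W -> W} := HB.pack (@GRing.scale R W) m.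
have cF : continuous (fun p : R * W => F p.1 p.2) by exact: scale_continuous.
have dF := differentiable_bilin (a x, A x) cF.
have dp : differentiable (fun z => (a z, A z)) x by exact: differentiable_pair.
have := is_diff_comp (differentiableP dp) (differentiableP dF).
by rewrite diff_bilin // diff_pair.
Qed.

Lemma differentiable_scale (V W : normedModType R) (a : V -> R) (A : V -> W) x :
  differentiable a x -> differentiable A x ->
  differentiable (fun z => a z *: A z) x.
Proof. by move=> da dA; have [] := is_diff_scale da dA. Qed.

Lemma derive_scale (V W : normedModType R) (a : V -> R) (A : V -> W) x v :
  differentiable a x -> differentiable A x ->
  'D_v (fun z => a z *: A z) x = 'D_v a x *: A x + a x *: 'D_v A x.
Proof.
move=> da dA; have [daA dE] := is_diff_scale da dA.
by rewrite !deriveE // dE addrC.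
Qed.

Lemma differentiable_mulmx (V : normedModType R) m n p
    (A : V -> 'M[R]_(m, n)) (B : V -> 'M[R]_(n, p)) x :
  differentiable A x -> differentiable B x ->
  differentiable (fun z => A z *m B z) x.
Proof.
move=> /differentiable_mxP dA /differentiable_mxP dB.
apply/differentiable_mxP => i j.
have -> : (fun z => (A z *m B z) i j) = (fun z => \sum_k A z i k * B z k j).
  by apply/funext => z; rewrite mxE.
by apply: differentiable_bigsum => k; exact: differentiableM.
Qed.

Lemma derive_mulmx (V : normedModType R) m n p
    (A : V -> 'M[R]_(m, n)) (B : V -> 'M[R]_(n, p)) x v :
  differentiable A x -> differentiable B x ->
  'D_v (fun z => A z *m B z) x = 'D_v A x *m B x + A x *m 'D_v B x.
Proof.
move=> dA dB; have dAB := differentiable_mulmx dA dB.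
rewrite !derive_mx; do ?exact: diff_derivable.
move/differentiable_mxP: dA => dA; move/differentiable_mxP: dB => dB.
apply/matrixP => i j; rewrite !mxE.
have -> : (fun z => (A z *m B z) i j) = (fun z => \sum_k A z i k * B z k j).
  by apply/funext => z; rewrite mxE.
rewrite derive_bigsum => [|k]; last exact: differentiableM.
rewrite -big_split; apply: eq_bigr => k _ /=; rewrite !mxE.
rewrite deriveM; do ?exact: diff_derivable.
by rewrite addrC; congr (_ + _); exact: mulrC.
Qed.

Lemma differentiable_trmx (V : normedModType R) m n (A : V -> 'M[R]_(m, n)) x :
  differentiable A x -> differentiable (fun z => (A z)^T) x.
Proof.
move=> /differentiable_mxP dA; apply/differentiable_mxP => i j.
have -> : (fun z => (A z)^T i j) = (fun z => A z j i); last exact: dA.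
by apply/funext => z; rewrite mxE.
Qed.

Lemma derive_trmx (V : normedModType R) m n (A : V -> 'M[R]_(m, n)) x v :
  differentiable A x -> 'D_v (fun z => (A z)^T) x = ('D_v A x)^T.
Proof.
move=> dA; have dAT := differentiable_trmx dA.
rewrite !derive_mx; do ?exact: diff_derivable.
apply/matrixP => i j; rewrite !mxE.
by have -> : (fun z => (A z)^T i j) = (fun z => A z j i)
  by apply/funext => z; rewrite mxE.
Qed.

Lemma differentiable_det (V : normedModType R) n (A : V -> 'M[R]_n) x :
  differentiable A x -> differentiable (fun z => \det (A z)) x.
Proof.
move=> /differentiable_mxP dA; rewrite /determinant.
apply: differentiable_bigsum => s.
apply: differentiableM; first exact: differentiable_cst.
by apply: differentiable_bigprod => i; exact: dA.
Qed.

(** Near [x] the inverse is the adjugate divided by the determinant, both polynomial in the entries.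
    Invertibility is asked on a neighbourhood because [invmx] returns a singular matrix
    unchanged. *)
Lemma differentiable_invmx (V : normedModType R) n (A : V -> 'M[R]_n) x :
  (\forall z \near x, A z \in unitmx) ->
  differentiable A x -> differentiable (fun z => invmx (A z)) x.
Proof.
move=> uA dA.
apply: (@near_eq_differentiable _ _ (fun z => (\det (A z))^-1 *: \adj (A z))).
  by apply: filterS uA => z uz; rewrite /invmx uz.
apply: differentiable_scale.
  apply: differentiableV; first exact: differentiable_det.
  by have := nbhs_singleton uA; rewrite unitmxE unitfE.
move/differentiable_mxP: dA => dA; apply/differentiable_mxP => i j.
have -> : (fun z => \adj (A z) i j) = (fun z => (-1) ^+ (j + i) *:
    \det (row' j (col' i (A z)))).
  by apply/funext => z; rewrite mxE.
apply: (@differentiableZ _ _ _ (fun z => \det (row' j (col' i (A z))))).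
apply: differentiable_det; apply/differentiable_mxP => k l.
have -> : (fun z => (row' j (col' i (A z))) k l) =
          (fun z => A z (lift j k) (lift i l)); last exact: dA.
by apply/funext => z; rewrite !mxE.
Qed.

Lemma derive_comp (U V W : normedModType R) (f : U -> V) (g : V -> W) x v :
  differentiable f x -> differentiable g (f x) ->
  'D_v (g \o f) x = 'D_('D_v f x) g (f x).
Proof.
move=> df dg; rewrite deriveE; last exact: differentiable_comp.
by rewrite diff_comp //= !deriveE.
Qed.

Lemma derive_sum_delta n (W : normedModType R) (f : 'rV[R]_n -> W) x v :
  differentiable f x ->
  'D_v f x = \sum_l v 0 l *: 'D_(delta_mx 0 l) f x.
Proof.
move=> df; rewrite {1}(row_sum_delta v) deriveE // linear_sum.
by apply: eq_bigr => l _; rewrite linearZ deriveE.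
Qed.

End Differentiability.

(** * Maps of class C^k and symmetry of second derivatives *)

Section Ck.
Context {R : realType}.

Lemma Ck_onW (V W : normedModType R) k (U : set V) (f : V -> W) :
  Ck_on k.+1 U f -> Ck_on k U f.
Proof.
elim: k f => [|k IH] f [df Df];
  first by move=> x /df /differentiable_continuous.
by split=> // v; exact: IH.
Qed.

Lemma Ck_on_derive (V W : normedModType R) k (U : set V) (f : V -> W) v :
  Ck_on k.+1 U f -> Ck_on k U ('D_v f).
Proof. by case=> _; exact. Qed.

(** Serves to glue: the composite of two immersions is factored through an intermediate chart that
    changes from point to point. *)
Lemma Ck_on_local (V W : normedModType R) k (U : set V) (f : V -> W) :
  (forall x, U x -> exists2 U', U' x & Ck_on k U' f) -> Ck_on k U f.
Proof.
elim: k f => [|k IH] f Uf /=; first by move=> x /Uf[U' U'x]; exact.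
split=> [x /Uf[U' U'x []]|v]; first by move=> + _; exact.
by apply: IH => x /Uf[U' U'x [_ /(_ v)]]; exists U'.
Qed.

(** On an open set, equality on [U] is equality near each of its points; hence the directional
    derivatives also agree on [U], and the induction goes on with them. *)
Lemma Ck_on_eq (V W : normedModType R) k (U : set V) (f g : V -> W) :
  open U -> (forall x, U x -> f x = g x) -> Ck_on k U f -> Ck_on k U g.
Proof.
move=> oU; elim: k f g => [|k IH] f g fg.
  move=> cf x Ux; have fgx : \near x, f x = g x.
    by apply: filterS fg _; exact: open_nbhs_nbhs.
  rewrite /prop_for /continuous_at -(fg x Ux).
  exact: cvg_trans (near_eq_cvg fgx) (cf x Ux).
have near_fg x : U x -> \near x, f x = g x.
  by move=> Ux; apply: filterS fg _; exact: open_nbhs_nbhs.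
move=> [df Df]; split=> [x Ux|v].
  exact: near_eq_differentiable (near_fg x Ux) (df x Ux).
by apply: (IH _ _ _ (Df v)) => x /near_fg; exact: near_eq_derive.
Qed.

Lemma Ck_on_cst (V W : normedModType R) k (U : set V) (w : W) :
  Ck_on k U (cst w : V -> W).
Proof.
elim: k w => [|k IH] w; first by move=> x _; exact: cst_continuous.
split=> [x _|v]; first exact: differentiable_cst.
have -> : (fun x => 'D_v (cst w) x) = cst (0 : W).
  by apply/funext => x; rewrite derive_cst.
exact: IH.
Qed.

Lemma Ck_onD (V W : normedModType R) k (U : set V) (f g : V -> W) :
  open U -> Ck_on k U f -> Ck_on k U g -> Ck_on k U (fun x => f x + g x).
Proof.
move=> oU; elim: k f g => [|k IH] f g.
  by move=> cf cg x Ux; apply: continuousD; [exact: cf|exact: cg].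
move=> [df Df] [dg Dg]; split=> [x Ux|v].
  by apply: differentiableD; [exact: df|exact: dg].
apply: Ck_on_eq (IH _ _ (Df v) (Dg v)) => // x Ux.
by rewrite -deriveD //; apply: diff_derivable; do ?[exact: df|exact: dg].
Qed.

Lemma Ck_on_sum (V W : normedModType R) k (U : set V) (I : finType)
    (f : I -> V -> W) :
  open U -> (forall i, Ck_on k U (f i)) -> Ck_on k U (fun x => \sum_i f i x).
Proof.
move=> oU Cf; have -> : (fun x => \sum_i f i x) = \sum_i f i.
  by apply/funext => x; rewrite fct_sumE.
by elim/big_ind : _ => [|? ? ? ?|//]; [exact: Ck_on_cst|exact: Ck_onD].
Qed.

Lemma Ck_on_scale (V W : normedModType R) k (U : set V) (a : V -> R)
    (A : V -> W) :
  open U -> Ck_on k U a -> Ck_on k U A -> Ck_on k U (fun x => a x *: A x).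
Proof.
move=> oU; elim: k a A => [|k IH] a A.
  by move=> ca cA x Ux; apply: continuousZ; [exact: ca|exact: cA].
move=> Ca CA; have [[da _] [dA _]] := (Ca, CA); split=> [x Ux|v].
  by apply: differentiable_scale; [exact: da|exact: dA].
apply: (@Ck_on_eq _ _ _ _ (fun x => 'D_v a x *: A x + a x *: 'D_v A x)) => //.
  by move=> x Ux; rewrite derive_scale //; [exact: da|exact: dA].
apply: Ck_onD => //; apply: IH; do ?[exact: Ck_on_derive|exact: Ck_onW].
Qed.

Lemma Ck_on_coord (V : normedModType R) m n k (U : set V)
    (A : V -> 'M[R]_(m, n)) i j : open U -> Ck_on k U A -> Ck_on k U (fun x => A x i j).
Proof.
move=> oU; elim: k A => [|k IH] A.
  move=> cA x Ux;
  apply: (@continuous_comp _ _ _ A (fun N : 'M[R]_(m, n) => N i j)).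
    exact: cA.
  exact: coord_continuous.
move=> [dA DA]; split=> [x /dA /differentiable_mxP|v]; first exact.
apply: Ck_on_eq (IH _ (DA v)) => // x /dA dAx.
by rewrite derive_mx ?mxE //; exact: diff_derivable.
Qed.

(** In the chain rule the direction ['D_v f x] varies with [x]. Expanding it in the standard basis
    leaves coordinates of ['D_v f] times fixed directional derivatives of [g] composed with [f], to
    which the induction hypothesis applies. *)
Lemma Ck_on_comp (V W : normedModType R) n k (U : set V) (U' : set 'rV[R]_n)
    (f : V -> 'rV[R]_n) (g : 'rV[R]_n -> W) :
  open U -> (forall x, U x -> U' (f x)) ->
  Ck_on k U f -> Ck_on k U' g -> Ck_on k U (g \o f).
Proof.
move=> oU fU; elim: k f g fU => [|k IH] f g fU.
  move=> cf cg x Ux; apply: continuous_comp; [exact: cf|exact/cg/fU].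
move=> Cf Cg; have [[df _] [dg _]] := (Cf, Cg); split=> [x Ux|v].
  by apply: differentiable_comp; [exact: df|exact/dg/fU].
apply: (@Ck_on_eq _ _ _ _
  (fun x => \sum_l ('D_v f x) 0 l *: 'D_(delta_mx 0 l) g (f x))) => //.
  move=> x Ux; rewrite [RHS]derive_comp; [|exact: df|exact/dg/fU].
  by rewrite [RHS]derive_sum_delta //; exact/dg/fU.
apply: Ck_on_sum => // l; apply: Ck_on_scale => //.
  exact/Ck_on_coord/Ck_on_derive.
exact: (IH f ('D_(delta_mx 0 l) g) fU (Ck_onW Cf) (Ck_on_derive _ Cg)).
Qed.

Lemma smooth_differentiable (V W : normedModType R) (U : set V) (f : V -> W) x :
  smooth_on U f -> U x -> differentiable f x.
Proof. by move=> /(_ 1%N)[+ _]; exact. Qed.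

Lemma smooth_derive (V W : normedModType R) (U : set V) (f : V -> W) v :
  smooth_on U f -> smooth_on U (fun x => 'D_v f x).
Proof. by move=> sf k; have [_] := sf k.+1; exact. Qed.

End Ck.

(** * Symmetry of second derivatives *)

Section Schwarz.
Context {R : realType} {V : normedModType R}.

Lemma is_derive_line (f : V -> R) (x v : V) (t : R) :
  differentiable f (x + t *: v) ->
  is_derive t 1 (fun s => f (x + s *: v)) ('D_v f (x + t *: v)).
Proof.
move=> df; have dl : is_derive t 1 (fun s : R => x + s *: v) v.
  have ds : is_diff t (fun s : R => s *: v) (fun s : R => s *: v).
    exact: is_diff_scalel.
  have dx : is_diff t (fun=> x : V) (fun _ : R => 0 : V) by exact: is_diff_cst.
  have dD := is_diffD dx ds.
  apply: DeriveDef; first by apply/diff_derivable; case: dD.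
  by rewrite deriveE; case: dD => // _ ->; rewrite !fctE add0r scale1r.
have dd : differentiable (fun s : R => x + s *: v) t.
  by apply/derivable1_diffP; case: dl.
apply: DeriveDef; first exact/diff_derivable/(differentiable_comp dd df).
by rewrite (derive_comp _ dd df) (@derive_val _ _ _ _ _ _ _ dl).
Qed.

(* Mean value theorem in the direction [v], then in the direction [w]. *)
Lemma second_difference (f : V -> R) (x v w : V) (t : R) : 0 < t ->
  (forall a b, a \in `[0, t] -> b \in `[0, t] ->
     differentiable f (x + a *: v + b *: w) /\
     differentiable ('D_v f) (x + a *: v + b *: w)) ->
  exists a b, [/\ a \in `[0, t], b \in `[0, t] &
    f (x + t *: v + t *: w) - f (x + t *: v) - (f (x + t *: w) - f x) =
    'D_w ('D_v f) (x + a *: v + b *: w) * t * t].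
Proof.
move=> t0 df.
have in0 : 0 \in `[0, t] by rewrite in_itv /= lexx ltW.
have int : t \in `[0, t] by rewrite in_itv /= lexx ltW.
(* [h t - h 0] is the double difference, and the derivative of [h] is an increment of ['D_v f] in
   the direction [w]. *)
pose h s := f (x + t *: w + s *: v) - f (x + s *: v).
have dh s : s \in `[0, t] ->
    is_derive s 1 h ('D_v f (x + s *: v + t *: w) - 'D_v f (x + s *: v)).
  move=> sI; apply: is_deriveB; last first.
    by apply: is_derive_line; have [] := df s 0 sI in0; rewrite scale0r addr0.
  by rewrite addrAC; apply: is_derive_line; have [] := df s t sI int;
     rewrite addrAC.
have sub s : s \in `]0, t[ -> s \in `[0, t] by exact: subset_itv_oo_cc.
have [] := @MVT _ h _ _ _ t0 (fun s sI => dh s (sub s sI)).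
  apply: derivable_within_continuous => s /dh []; exact.
move=> a /sub aI; rewrite /h !scale0r !addr0 subr0 => hE.
pose g s := 'D_v f (x + a *: v + s *: w).
have dg s : s \in `[0, t] ->
    is_derive s 1 g ('D_w ('D_v f) (x + a *: v + s *: w)).
  by move=> sI; apply: is_derive_line; have [] := df a s aI sI.
have [] := @MVT _ g _ _ _ t0 (fun s sI => dg s (sub s sI)).
  apply: derivable_within_continuous => s /dg []; exact.
move=> b /sub bI; rewrite /g !scale0r !addr0 subr0 => gE.
by exists a, b; split=> //; rewrite -gE -hE (addrAC x (t *: w)); ring.
Qed.

(** The conclusion of [second_difference] with [A] in place of ['D_w ('D_v f)], for parallelograms
    contained in the ball of radius [d]. *)
Let mean_value_rep (A : V -> R) (f : V -> R) (x v w : V) (d : R) :=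
  forall t : R, 0 < t ->
    (forall a b, a \in `[0, t] -> b \in `[0, t] ->
       ball x d (x + a *: v + b *: w)) ->
    exists a b, [/\ a \in `[0, t], b \in `[0, t] &
      f (x + t *: v + t *: w) - f (x + t *: v) - (f (x + t *: w) - f x) =
      A (x + a *: v + b *: w) * t * t].

(* Stated for arbitrary [A] and [B]: on the second derivatives themselves,
   unification would try to identify the two by unfolding limits. *)
Lemma second_difference_eq (A B f : V -> R) (x v w : V) (d : R) : 0 < d ->
  {for x, continuous A} -> {for x, continuous B} ->
  mean_value_rep A f x w v d -> mean_value_rep B f x v w d -> A x = B x.
Proof.
move=> d0 cA cB diffA diffB.
apply/eqP; rewrite -subr_eq0 -normr_le0; apply/ler_addgt0Pr => e e0.
have e2 : 0 < e / 2 by rewrite divr_gt0.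
have near_x : \forall y \near x, `|A x - A y| < e / 2 /\ `|B x - B y| < e / 2.
  by near=> y; split; near: y; [move/cvgrPdist_lt: cA|move/cvgrPdist_lt: cB];
     exact.
have /nbhs_ballP[d' /= d'0 xd'] := near_x.
(* With this side the whole parallelogram stays in both balls, since [t * (|v| + |w|)] is less than
   the minimum of the radii. The added 1 makes the inequality strict and keeps the denominator
   positive when [v] and [w] vanish. *)
pose t := Num.min d d' / (`|v| + `|w| + 1).
have nvw : 0 < `|v| + `|w| + 1 by rewrite ltr_wpDl // addr_ge0.
have t0 : 0 < t by rewrite divr_gt0 // lt_min d0.
have inU a b : a \in `[0, t] -> b \in `[0, t] ->
    `|a *: v + b *: w| < Num.min d d'.
  rewrite !in_itv /= => /andP[a0 aT] /andP[b0 bT].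
  rewrite (le_lt_trans (ler_normD _ _)) // !normrZ !ger0_norm //.
  have : a * `|v| + b * `|w| <= t * `|v| + t * `|w|.
    by rewrite lerD // ler_wpM2r.
  move=> /le_lt_trans; apply; rewrite -mulrDr.
  by rewrite /t mulrAC ltr_pdivrMr // ltr_pM2l ?ltrDl // lt_min d0.
have inUvw a b : a \in `[0, t] -> b \in `[0, t] ->
    ball x d (x + a *: v + b *: w) /\ ball x d' (x + a *: v + b *: w).
  move=> aI bI; have := inU a b aI bI; rewrite lt_min => /andP[? ?].
  by rewrite -!ball_normE /= -addrA opprD addNKr normrN.
have inUwv a b : a \in `[0, t] -> b \in `[0, t] ->
    ball x d (x + a *: w + b *: v) /\ ball x d' (x + a *: w + b *: v).
  by move=> aI bI; rewrite addrAC; exact: inUvw.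
have [a1 [b1 [a1I b1I E1]]] := diffB t t0
  (fun a b aI bI => (inUvw a b aI bI).1).
have [a2 [b2 [a2I b2I E2]]] := diffA t t0
  (fun a b aI bI => (inUwv a b aI bI).1).
(* The double difference is symmetric in [v] and [w], so the two representations have the same
   value; the factor [t * t] cancels. *)
have BA : B (x + a1 *: v + b1 *: w) = A (x + a2 *: w + b2 *: v).
  have tt0 : t != 0 by rewrite gt_eqF.
  apply: (mulIf tt0); apply: (mulIf tt0); rewrite -E1 -E2.
  by rewrite (addrAC x (t *: w)); ring.
have [_ hB] := xd' _ (inUvw _ _ a1I b1I).2.
have [hA _] := xd' _ (inUwv _ _ a2I b2I).2.
rewrite add0r (splitr e); rewrite BA distrC in hB.
have -> : A x - B x = (A x - A (x + a2 *: w + b2 *: v)) +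
                      (A (x + a2 *: w + b2 *: v) - B x) by ring.
by rewrite (le_trans (ler_normD _ _)) // lerD // ltW.
Unshelve. all: by end_near. Qed.

Lemma derive_comm_real (U : set V) (f : V -> R) (x v w : V) :
  open U -> U x -> Ck_on 2 U f -> 'D_v ('D_w f) x = 'D_w ('D_v f) x.
Proof.
move=> oU Ux [df Df].
have dDf u y : U y -> differentiable ('D_u f) y by have [+ _] := Df u; exact.
have cDDf u1 u2 : {for x, continuous ('D_u1 ('D_u2 f))}.
  by have [_ /(_ u1)] := Df u2; exact.
have [d d0 xdU] : exists2 d, 0 < d & ball x d `<=` U.
  by apply/nbhs_ballP; exact: open_nbhs_nbhs.
have diff2 u1 u2 : mean_value_rep ('D_u2 ('D_u1 f)) f x u1 u2 d.
  move=> t t0 inU; apply: second_difference t0 _ => a b aI bI.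
  by have /xdU Uy := inU a b aI bI; split; [exact: df|exact: dDf].
exact: (second_difference_eq d0 (cDDf v w) (cDDf w v) (diff2 w v) (diff2 v w)).
Qed.

(** Both second derivatives are computed entry by entry, which reduces the claim to real-valued
    functions. *)
Lemma derive_comm m n (U : set V) (f : V -> 'M[R]_(m, n)) (x v w : V) :
  open U -> U x -> Ck_on 2 U f -> 'D_v ('D_w f) x = 'D_w ('D_v f) x.
Proof.
move=> oU Ux Cf; have [df Df] := Cf.
have dDf u : differentiable ('D_u f) x by have [+ _] := Df u; exact.
apply/matrixP => i j.
have E1 u : \near x, 'D_u f x i j = 'D_u (fun z => f z i j) x.
  have : \forall y \near x, U y by exact: open_nbhs_nbhs.
  apply: filterS => y /df dfy.
  by rewrite derive_mx ?mxE //; exact: diff_derivable.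
have E2 u1 u2 : 'D_u1 ('D_u2 f) x i j = 'D_u1 ('D_u2 (fun z => f z i j)) x.
  rewrite (derive_mx (@diff_derivable _ _ _ _ _ u1 (dDf u2))) mxE.
  exact: near_eq_derive (E1 u2).
apply: (etrans (E2 v w)); apply: (etrans _ (esym (E2 w v))).
exact: (derive_comm_real _ _ oU Ux (Ck_on_coord i j oU Cf)).
Qed.

End Schwarz.

(** * Linear algebra of inner products *)

Section Bilin.
Context {R : realType} {n : nat}.
Implicit Types (A B : 'M[R]_n) (u v w : 'rV[R]_n).

Lemma bilinDl A v v' w : bilin A (v + v') w = bilin A v w + bilin A v' w.
Proof. by rewrite /bilin !mulmxDl mxE. Qed.

Lemma bilinDr A v w w' : bilin A v (w + w') = bilin A v w + bilin A v w'.
Proof. by rewrite /bilin linearD mulmxDr mxE. Qed.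

Lemma bilinZl A a v w : bilin A (a *: v) w = a * bilin A v w.
Proof. by rewrite /bilin -!scalemxAl mxE. Qed.

Lemma bilinZr A a v w : bilin A v (a *: w) = a * bilin A v w.
Proof. by rewrite /bilin linearZ -scalemxAr mxE. Qed.

Lemma bilin0l A w : bilin A 0 w = 0.
Proof. by rewrite /bilin !mul0mx mxE. Qed.

Lemma bilin0r A v : bilin A v 0 = 0.
Proof. by rewrite /bilin trmx0 mulmx0 mxE. Qed.

Lemma bilin_delta A i j : bilin A (delta_mx 0 i) (delta_mx 0 j) = A i j.
Proof. by rewrite /bilin trmx_delta -rowE -colE !mxE. Qed.

Lemma bilin_mulr m A (J : 'M[R]_(m, n)) v (w : 'rV[R]_m) :
  bilin A v (w *m J) = (v *m A *m J^T *m w^T) 0 0.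
Proof. by rewrite /bilin trmx_mul mulmxA. Qed.

Lemma bilin_mul m A (J : 'M[R]_(m, n)) (v w : 'rV[R]_m) :
  bilin A (v *m J) (w *m J) = bilin (J *m A *m J^T) v w.
Proof. by rewrite bilin_mulr /bilin !mulmxA. Qed.

Lemma bilin_orthogonal m A (J : 'M[R]_(m, n)) v :
  (forall w : 'rV[R]_m, bilin A v (w *m J) = 0) <-> v *m A *m J^T = 0.
Proof.
split=> [vJ|vJ w]; last by rewrite bilin_mulr vJ mul0mx mxE.
apply/rowP => i; have := vJ (delta_mx 0 i).
by rewrite bilin_mulr trmx_delta -colE !mxE.
Qed.

Definition posdef A := A^T = A /\ forall v, v != 0 -> 0 < bilin A v v.

Lemma posdef_eq0 A v : posdef A -> bilin A v v = 0 -> v = 0.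
Proof.
by move=> [_ pA] Av; apply/eqP/negPn/negP => /pA; rewrite Av ltxx.
Qed.

(** A vector in the kernel of [A] has zero length, hence is zero. *)
Lemma posdef_unit A : posdef A -> A \in unitmx.
Proof.
move=> pA; rewrite -row_free_unit -kermx_eq0; apply/rowV0P => v /sub_kermxP vA.
by apply: posdef_eq0 pA _; rewrite /bilin vA mul0mx mxE.
Qed.

(* In codimension one the normal space is spanned by any nonzero normal [H]. *)
Lemma orthogonal_hyperplane_eq0 m A (J : 'M[R]_(m, n)) (H xi : 'rV[R]_n) :
  n = m.+1 -> posdef A -> row_free J -> H != 0 ->
  H *m A *m J^T = 0 -> xi *m A *m J^T = 0 -> bilin A xi H = 0 -> xi = 0.
Proof.
move=> nm pA fJ H0 HJ xiJ xiH.
have pAs : A^T = A by case: pA.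
(* Pairing a vanishing combination of the rows with [H] leaves its coefficient on [H] times the
   nonzero squared length of [H]; that coefficient is therefore zero, and [row_free J] disposes of
   the others. *)
have fJH : row_free (col_mx J H).
  rewrite -kermx_eq0; apply/rowV0P => v /sub_kermxP.
  rewrite -[v]hsubmxK mul_row_col => vJH.
  have rH : rsubmx v *m H = rsubmx v 0 0 *: H.
    by rewrite {1}[rsubmx v]mx11_scalar mul_scalar_mx.
  have : bilin A H (lsubmx v *m J + rsubmx v *m H) = 0 by rewrite vJH bilin0r.
  rewrite bilinDr bilin_mulr HJ mul0mx mxE add0r rH bilinZr => /eqP.
  rewrite mulf_eq0 => /orP[/eqP r0|/eqP AH]; last first.
    by move/eqP: H0; rewrite (posdef_eq0 pA AH).
  move: vJH; rewrite rH r0 scale0r addr0 => /eqP.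
  rewrite mulmx_free_eq0 // => /eqP ->.
  by rewrite [rsubmx v]mx11_scalar r0 raddf0 row_mx0.
(* [xi] is orthogonal to [m.+1 = n] independent rows. As [A] is invertible, the matrix on the right
   has rank [n] and can be cancelled. *)
have : xi *m (A *m (col_mx J H)^T) = 0.
  rewrite tr_col_mx mul_mx_row mul_mx_row !mulmxA xiJ.
  suff -> : xi *m A *m H^T = 0 by rewrite row_mx0.
  by apply/matrixP => i j; rewrite !ord1 [RHS]mxE.
move/eqP; rewrite mulmx_free_eq0; first by move/eqP.
rewrite -[_ *m _]trmxK trmx_mul trmxK pAs /row_free mxrank_tr.
by rewrite mxrankMfree ?row_free_unit ?posdef_unit // (eqP fJH) nm addn1.
Qed.

Lemma tangent_partD m A (J : 'M[R]_(m, n)) (v w : 'rV[R]_n) :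
  tangent_part A J (v + w) = tangent_part A J v + tangent_part A J w.
Proof. by rewrite /tangent_part !mulmxDl. Qed.

Lemma normal_partD m A (J : 'M[R]_(m, n)) (v w : 'rV[R]_n) :
  normal_part A J (v + w) = normal_part A J v + normal_part A J w.
Proof. by rewrite /normal_part tangent_partD opprD addrACA. Qed.

Lemma normal_partZ m A (J : 'M[R]_(m, n)) a (v : 'rV[R]_n) :
  normal_part A J (a *: v) = a *: normal_part A J v.
Proof. by rewrite /normal_part /tangent_part -!scalemxAl scalerBr. Qed.

Lemma normal_part_id m A (J : 'M[R]_(m, n)) (v : 'rV[R]_n) :
  v *m A *m J^T = 0 -> normal_part A J v = v.
Proof. by rewrite /normal_part /tangent_part => ->; rewrite !mul0mx subr0. Qed.

Lemma normal_part_tangent m A (J : 'M[R]_(m, n)) (v : 'rV[R]_m) :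
  J *m A *m J^T \in unitmx -> normal_part A J (v *m J) = 0.
Proof.
move=> uJ; rewrite /normal_part /tangent_part.
have -> : v *m J *m A *m J^T = v *m (J *m A *m J^T) by rewrite !mulmxA.
by rewrite mulmxK // subrr.
Qed.

Lemma normal_part_orthogonal_mx m A (J : 'M[R]_(m, n)) (v : 'rV[R]_n) :
  J *m A *m J^T \in unitmx -> normal_part A J v *m A *m J^T = 0.
Proof.
by move=> uJ; apply/bilin_orthogonal => w; exact: normal_part_orthogonal.
Qed.

End Bilin.

(** Since [JF] is isometric from [B] to [A], the Gram matrix of the rows of [Jf *m JF] for [A] is
    that of the rows of [Jf] for [B], and so are the inner products with [xi]. *)
Lemma normal_part_comp (R : realType) k n p (A : 'M[R]_p) (B : 'M[R]_n)
    (Jf : 'M[R]_(k, n)) (JF : 'M[R]_(n, p)) (xi : 'rV[R]_n) :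
  B = JF *m A *m JF^T ->
  normal_part A (Jf *m JF) (xi *m JF) = normal_part B Jf xi *m JF.
Proof.
by move=> ->; rewrite /normal_part /tangent_part mulmxBl trmx_mul !mulmxA.
Qed.

(** * Derivatives of inner products, and Jacobians *)

Section LocalCalculus.
Context {R : realType}.

Lemma differentiable_bilin_form (V : normedModType R) n (A : V -> 'M[R]_n)
    (p q : V -> 'rV[R]_n) x :
  differentiable A x -> differentiable p x -> differentiable q x ->
  differentiable (fun z => bilin (A z) (p z) (q z)) x.
Proof.
move=> dA dp dq.
have : differentiable (fun z => p z *m A z *m (q z)^T) x.
  by do ?[apply: differentiable_mulmx => //]; exact: differentiable_trmx.
by move/differentiable_mxP; exact.
Qed.

Lemma derive_bilin_form (V : normedModType R) n (A : V -> 'M[R]_n)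
    (p q : V -> 'rV[R]_n) x v :
  differentiable A x -> differentiable p x -> differentiable q x ->
  'D_v (fun z => bilin (A z) (p z) (q z)) x =
  bilin ('D_v A x) (p x) (q x) + bilin (A x) ('D_v p x) (q x) +
  bilin (A x) (p x) ('D_v q x).
Proof.
move=> dA dp dq.
have dq' := differentiable_trmx dq; have dpA := differentiable_mulmx dp dA.
have dpAq := differentiable_mulmx dpA dq'.
have := derive_mx (@diff_derivable _ _ _ _ x v dpAq).
move/matrixP/(_ 0 0); rewrite mxE => <-.
rewrite (derive_mulmx v dpA dq') (derive_mulmx v dp dA) (derive_trmx v dq).
have mxD (M N : 'M[R]_1) : (M + N) 0 0 = M 0 0 + N 0 0 by rewrite mxE.
by rewrite mulmxDl !mxD /bilin [in RHS](addrC (fun_of_matrix _ _ _)).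
Qed.

Lemma Ck_on_mx (V : normedModType R) m n k (U : set V) (A : V -> 'M[R]_(m, n)) :
  open U -> (forall i j, Ck_on k U (fun z => A z i j)) -> Ck_on k U A.
Proof.
move=> oU CA.
have -> : A = (fun z => \sum_i \sum_j A z i j *: delta_mx i j).
  by apply/funext => z; rewrite [LHS]matrix_sum_delta.
apply: Ck_on_sum => // i; apply: Ck_on_sum => // j.
by apply: Ck_on_scale => //; exact: Ck_on_cst.
Qed.

Lemma smooth_jacobian m n (U : set 'rV[R]_m) (f : 'rV[R]_m -> 'rV[R]_n) :
  open U -> smooth_on U f -> smooth_on U (jacobian f).
Proof.
move=> oU sf k; apply: Ck_on_mx => // i j.
apply: (@Ck_on_eq _ _ _ _ _ (fun z => 'D_(delta_mx 0 i) f z 0 j)) => //.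
  move=> z Uz; rewrite deriveEjacobian -?rowE ?mxE //.
  exact: smooth_differentiable sf Uz.
by apply: Ck_on_coord => //; exact: smooth_derive.
Qed.

Lemma jacobian_comp k n p (f : 'rV[R]_k -> 'rV[R]_n)
    (F : 'rV[R]_n -> 'rV[R]_p) (G : 'rV[R]_k -> 'rV[R]_p) y :
  (\near y, G y = F (f y)) -> differentiable f y -> differentiable F (f y) ->
  'J G y = 'J f y *m 'J F (f y).
Proof.
move=> GE df dF; have dG : differentiable G y.
  apply: near_eq_differentiable (differentiable_comp df dF).
  by apply: filterS GE => z ->.
apply/row_matrixP => i; rewrite row_mul !rowE -!deriveEjacobian //.
by rewrite (near_eq_derive _ GE) (derive_comp _ df dF).
Qed.

End LocalCalculus.

(** * Immersions in coordinates *)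

Section LocalGeometry.
Context {R : realType}.

Definition gram_field n (U : set 'rV[R]_n) (g : 'rV[R]_n -> 'M[R]_n) : Prop :=
  [/\ open U, smooth_on U g & forall x, U x -> posdef (g x)].

(** The coordinate expression of an isometric immersion, with [h] the metric of the source and [g]
    that of the target. All maps are total; only their behaviour on [U] and [U'] is constrained. *)
Definition local_immersion k n (U : set 'rV[R]_k) (h : 'rV[R]_k -> 'M[R]_k)
    (U' : set 'rV[R]_n) (g : 'rV[R]_n -> 'M[R]_n) (f : 'rV[R]_k -> 'rV[R]_n)
    : Prop :=
  [/\ gram_field U h, gram_field U' g, smooth_on U f &
      forall y, U y -> [/\ U' (f y), row_free ('J f y) &
        h y = 'J f y *m g (f y) *m ('J f y)^T]].

(* Coordinate versions of [cov_deriv], [second_form] and [mean_curvature] for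
   constant fields [v] and [w], convertible to them on charts. *)
Definition local_cov k n (g : 'rV[R]_n -> 'M[R]_n) (f : 'rV[R]_k -> 'rV[R]_n)
    (v : 'rV[R]_k) (eta : 'rV[R]_k -> 'rV[R]_n) (y : 'rV[R]_k) : 'rV[R]_n :=
  'D_v eta y + christoffel g (f y) (v *m 'J f y) (eta y).

Definition local_second_form k n (g : 'rV[R]_n -> 'M[R]_n)
    (f : 'rV[R]_k -> 'rV[R]_n) (v w y : 'rV[R]_k) : 'rV[R]_n :=
  normal_part (g (f y)) ('J f y) (local_cov g f v (fun z => w *m 'J f z) y).

Definition local_mean_curvature k n (h : 'rV[R]_k -> 'M[R]_k)
    (g : 'rV[R]_n -> 'M[R]_n) (f : 'rV[R]_k -> 'rV[R]_n) (y : 'rV[R]_k)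
    : 'rV[R]_n :=
  k%:R^-1 *: \sum_i \sum_j
    invmx (h y) i j *: local_second_form g f (delta_mx 0 i) (delta_mx 0 j) y.

Lemma open_near (T : topologicalType) (U : set T) x :
  open U -> U x -> \forall z \near x, U z.
Proof. by move=> oU Ux; exact: open_nbhs_nbhs. Qed.

(** * Christoffel symbols of a metric in coordinates *)

Section GramField.
Variables (n : nat) (U : set 'rV[R]_n) (g : 'rV[R]_n -> 'M[R]_n).
Hypothesis gU : gram_field U g.

Lemma gram_diff x : U x -> differentiable g x.
Proof. by case: gU => _ sg _; exact: smooth_differentiable. Qed.

Lemma gram_near_sym x : U x -> \forall z \near x, (g z)^T = g z.
Proof.
case: gU => oU _ pg /(open_near oU); apply: filterS => z /pg[]; exact.
Qed.

Lemma gram_in_unit x : U x -> g x \in unitmx.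
Proof. by case: gU => _ _ pg /pg; exact: posdef_unit. Qed.

Lemma christoffelDr x v w w' : U x ->
  christoffel g x v (w + w') = christoffel g x v w + christoffel g x v w'.
Proof.
move=> /gram_diff dg; rewrite /christoffel -mulmxDl; congr (_ *m _).
apply/rowP => l; rewrite !mxE /koszul bilinDl bilinDr.
have -> : 'D_(w + w') g x = 'D_w g x + 'D_w' g x by rewrite !deriveE // linearD.
have bD A B p q : bilin (A + B) p q = bilin A p q + bilin B p q :> R.
  by rewrite /bilin mulmxDr mulmxDl mxE.
have E (a a' b b' c c' : R) : 2^-1 * (a + a' + (b + b') - (c + c')) =
  2^-1 * (a + b - c) + 2^-1 * (a' + b' - c') by ring.
by rewrite bD; exact: E.
Qed.

Lemma christoffel0r x v : U x -> christoffel g x v 0 = 0.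
Proof.
by move=> Ux; apply: (addrI (christoffel g x v 0));
   rewrite -christoffelDr // !addr0.
Qed.

Lemma differentiable_christoffel (V : normedModType R) (p a b : V -> 'rV[R]_n)
    z : U (p z) -> differentiable p z -> differentiable a z ->
  differentiable b z ->
  differentiable (fun z => christoffel g (p z) (a z) (b z)) z.
Proof.
move=> Upz dp da db; have [oU sg _] := gU.
have Up : \forall z' \near z, U (p z').
  exact: (differentiable_continuous dp) (open_near oU Upz).
have dD (c : V -> 'rV[R]_n) : differentiable c z ->
    differentiable (fun z => 'D_(c z) g (p z)) z.
  move=> dc.
  (* The direction [c z] moves with [z]; the basis expansion replaces it by fixed directional
     derivatives of [g] composed with [p]. *)
  apply: (@near_eq_differentiable _ _ _
    (fun z => \sum_l c z 0 l *: 'D_(delta_mx 0 l) g (p z))).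
    by apply: filterS Up => z' Uz'; rewrite -derive_sum_delta //; exact: gram_diff.
  apply: differentiable_bigsum => l; apply: differentiable_scale.
    by move/differentiable_mxP: dc; exact.
  exact: (differentiable_comp dp
    (smooth_differentiable (smooth_derive _ sg) Upz)).
apply: differentiable_mulmx; last first.
  apply: differentiable_invmx; last exact: (differentiable_comp dp (gram_diff Upz)).
  by apply: filterS Up => z'; exact: gram_in_unit.
apply/differentiable_mxP => i l.
have -> : (fun z => (\row_l koszul g (p z) (a z) (b z) (delta_mx 0 l)) i l) =
          (fun z => koszul g (p z) (a z) (b z) (delta_mx 0 l)).
  by apply/funext => z'; rewrite mxE.
apply: differentiableM; first exact: differentiable_cst.
apply: differentiableB; last first.
  by apply: differentiable_bilin_form => //; apply: dD; exact: differentiable_cst.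
apply: differentiableD; apply: differentiable_bilin_form => //;
  by [exact: dD|exact: differentiable_cst].
Qed.

End GramField.

(** * Gauss formula, mean curvature vector and normal fields of one immersion *)

Section Immersion.
Variables (k n : nat).
Variables (U : set 'rV[R]_k) (h : 'rV[R]_k -> 'M[R]_k).
Variables (U' : set 'rV[R]_n) (g : 'rV[R]_n -> 'M[R]_n).
Variable f : 'rV[R]_k -> 'rV[R]_n.
Hypothesis fI : local_immersion U h U' g f.

Let oU : open U. Proof. by case: fI => -[]. Qed.
Let hU : gram_field U h. Proof. by case: fI. Qed.
Let gU : gram_field U' g. Proof. by case: fI. Qed.
Let sf : smooth_on U f. Proof. by case: fI. Qed.
Let fU y : U y -> U' (f y). Proof. by case: fI => _ _ _ fI' /fI'[]. Qed.
Let hE y : U y -> h y = 'J f y *m g (f y) *m ('J f y)^T.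
Proof. by case: fI => _ _ _ fI' /fI'[]. Qed.
Let pg y : U y -> posdef (g (f y)).
Proof. by case: gU => _ _ + /fU; exact. Qed.
Let sJ : smooth_on U (jacobian f). Proof. exact: smooth_jacobian. Qed.
Let df y : U y -> differentiable f y.
Proof. exact: smooth_differentiable. Qed.
Let dJ y : U y -> differentiable (jacobian f) y.
Proof. exact: smooth_differentiable. Qed.
Let dgf y : U y -> differentiable (g \o f) y.
Proof.
by move=> Uy; exact: (differentiable_comp (df Uy) (gram_diff gU (fU Uy))).
Qed.
Let gramJ_unit y : U y -> 'J f y *m g (f y) *m ('J f y)^T \in unitmx.
Proof. by move=> Uy; rewrite -(hE Uy); exact: (gram_in_unit hU Uy). Qed.

Lemma derive_mul_jacobian (v w y : 'rV[R]_k) : U y ->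
  'D_v (fun z => w *m 'J f z) y = w *m 'D_v (jacobian f) y.
Proof.
move=> Uy; have := derive_mulmx v (differentiable_cst w y) (dJ Uy).
by rewrite derive_cst mul0mx add0r.
Qed.

(** Metric compatibility of the connection along [f]: the chain rule turns the derivative of
    [g \o f] along [v] into that of [g] along [v *m 'J f y], where [christoffel_metric] applies. *)
Lemma local_cov_metric v (p q : 'rV[R]_k -> 'rV[R]_n) y : U y ->
  differentiable p y -> differentiable q y ->
  'D_v (fun z => bilin (g (f z)) (p z) (q z)) y =
  bilin (g (f y)) (local_cov g f v p y) (q y) +
  bilin (g (f y)) (p y) (local_cov g f v q y).
Proof.
move=> Uy dp dq; have Ufy := fU Uy.
rewrite (derive_bilin_form v (dgf Uy) dp dq).
rewrite (derive_comp v (df Uy) (gram_diff gU Ufy)) (deriveEjacobian v (df Uy)).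
rewrite (christoffel_metric (gram_diff gU Ufy) (gram_near_sym gU Ufy)
                            (gram_in_unit gU Ufy)).
have E (a b c d : R) : a + b + c + d = c + a + (d + b) by ring.
by rewrite /local_cov bilinDl bilinDr; exact: E.
Qed.

(** The left-hand side gives the components of the tangential part of nabla_v (df w). It is
    symmetric in [v] and [w] and compatible with the induced metric [h], so uniqueness of the
    Levi-Civita connection identifies it. *)
Lemma local_cov_tangent (v w y : 'rV[R]_k) : U y ->
  local_cov g f v (fun z => w *m 'J f z) y *m g (f y) *m ('J f y)^T *m
    invmx (h y) = christoffel h y v w.
Proof.
move=> Uy; have Ufy := fU Uy.
pose B v w := local_cov g f v (fun z => w *m 'J f z) y *m g (f y) *m
  ('J f y)^T *m invmx (h y).
have BE u1 u2 u : bilin (h y) (B u1 u2) u =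
    bilin (g (f y)) (local_cov g f u1 (fun z => u2 *m 'J f z) y) (u *m 'J f y).
  by rewrite bilin_mulr /bilin /B mulmxKV //; exact: (gram_in_unit hU Uy).
have dwJ (u : 'rV[R]_k) : differentiable (fun z => u *m 'J f z) y.
  by apply: differentiable_mulmx; [exact: differentiable_cst|exact: dJ].
apply: (christoffel_unique (B := B) (gram_diff hU Uy) (gram_near_sym hU Uy)
                           (gram_in_unit hU Uy)).
  (* Symmetry: the Christoffel term is torsion-free, and what remains is a second derivative of [f],
     symmetric by [derive_comm]. *)
  move=> u1 u2; rewrite /B /local_cov.
  rewrite (christoffel_torsion_free (gram_diff gU Ufy) (gram_near_sym gU Ufy)).
  suff -> : 'D_u1 (fun z => u2 *m 'J f z) y = 'D_u2 (fun z => u1 *m 'J f z) y by [].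
  have E u : \forall z \near y, u *m 'J f z = 'D_u f z.
    by apply: filterS (open_near oU Uy) => z Uz; rewrite deriveEjacobian //; exact: df.
  apply: (etrans (near_eq_derive _ (E u2))).
  apply: (etrans _ (esym (near_eq_derive _ (E u1)))).
  exact: derive_comm oU Uy (sf 2).
(* Compatibility: [local_cov_metric] differentiates the inner product of two pushed-forward fields,
   which equals [bilin (h z) v' w'] near [y]. *)
move=> u v' w'; rewrite BE.
have gC := bilinC _ _ (pg Uy).1.
have -> : bilin (h y) v' (B u w') = bilin (h y) (B u w') v'.
  exact: bilinC (nbhs_singleton (gram_near_sym hU Uy)).
rewrite BE (gC _ (v' *m _)) -(local_cov_metric u Uy (dwJ v') (dwJ w')).
have -> : 'D_u (fun z => bilin (g (f z)) (v' *m 'J f z) (w' *m 'J f z)) y =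
          'D_u (fun z => bilin (h z) v' w') y.
  apply: near_eq_derive; apply: filterS (open_near oU Uy) => z Uz.
  by rewrite bilin_mul -hE.
rewrite (derive_bilin_form u (gram_diff hU Uy) (differentiable_cst v' y)
                           (differentiable_cst w' y)).
by rewrite !derive_cst bilin0l bilin0r !addr0.
Qed.

Lemma local_cov_gauss (v w y : 'rV[R]_k) : U y ->
  local_cov g f v (fun z => w *m 'J f z) y =
  christoffel h y v w *m 'J f y + local_second_form g f v w y.
Proof.
move=> Uy; rewrite -local_cov_tangent // /local_second_form /normal_part.
by rewrite /tangent_part -hE // addrC subrK.
Qed.

Lemma local_mean_curvature_normal y : U y ->
  local_mean_curvature h g f y *m g (f y) *m ('J f y)^T = 0.
Proof.
move=> Uy; rewrite -mulmxA -scalemxAl mulmx_suml big1 ?scaler0 // => i _.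
rewrite mulmx_suml big1 // => j _; rewrite -scalemxAl mulmxA.
by rewrite normal_part_orthogonal_mx ?scaler0 //; exact: gramJ_unit.
Qed.

(** The normal connection differentiates the mean curvature vector. It is built from derivatives of
    smooth data by products and by inverses of matrices that stay invertible on [U]. *)
Lemma local_mean_curvature_diff y : U y ->
  differentiable (local_mean_curvature h g f) y.
Proof.
move=> Uy; have nearU := open_near oU Uy.
have dJT := differentiable_trmx (dJ Uy).
apply: differentiableZ.
apply: differentiable_bigsum => i; apply: differentiable_bigsum => j.
apply: differentiable_scale.
  have : differentiable (fun z => invmx (h z)) y.
    apply: differentiable_invmx (gram_diff hU Uy).
    by apply: filterS nearU => z; exact: (gram_in_unit hU).
  by move/differentiable_mxP; exact.
have dcov : differentiable
    (local_cov g f (delta_mx 0 i) (fun z => delta_mx 0 j *m 'J f z)) y.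
  apply: differentiableD.
    apply: (@near_eq_differentiable _ _ _
      (fun z => delta_mx 0 j *m 'D_(delta_mx 0 i) (jacobian f) z)).
      by apply: filterS nearU => z Uz; rewrite derive_mul_jacobian.
    apply: differentiable_mulmx; first exact: differentiable_cst.
    exact: smooth_differentiable (smooth_derive _ sJ) Uy.
  apply: (differentiable_christoffel gU (fU Uy) (df Uy)).
    by apply: differentiable_mulmx; [exact: differentiable_cst|exact: dJ].
  by apply: differentiable_mulmx; [exact: differentiable_cst|exact: dJ].
apply: differentiableB => //.
apply: differentiable_mulmx; last exact: dJ.
apply: differentiable_mulmx.
  by apply: differentiable_mulmx => //; apply: differentiable_mulmx => //; exact: dgf.
apply: differentiable_invmx.
  by apply: filterS nearU => z; exact: gramJ_unit.
apply: differentiable_mulmx => //; apply: differentiable_mulmx; first exact: dJ.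
exact: dgf.
Qed.

(** Differentiating the constant squared length shows that the derivative of [eta] is orthogonal to
    [eta]. Its normal part is then orthogonal both to the hypersurface and to [eta], hence zero
    where [eta] is nonzero. *)
Lemma constant_length_normal_parallel (a : R) (eta : 'rV[R]_k -> 'rV[R]_n) v y :
  n = k.+1 -> U y -> differentiable eta y ->
  (forall z, U z -> eta z *m g (f z) *m ('J f z)^T = 0) ->
  (forall z, U z -> bilin (g (f z)) (eta z) (eta z) = a) ->
  normal_part (g (f y)) ('J f y) (local_cov g f v eta y) = 0.
Proof.
move=> nk Uy deta etaN etaA; have [_ _ _ /(_ _ Uy)[_ fJ _]] := fI.
(* If [eta] vanishes at [y] then [a] is zero, so [eta] vanishes on the whole open set [U] and so
   does its derivative. *)
have [eta0|eta0] := eqVneq (eta y) 0.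
  have {}eta0 z : U z -> eta z = 0.
    move=> Uz; apply: posdef_eq0 (pg Uz) _.
    by rewrite etaA // -(etaA y) // eta0 bilin0l.
  have -> : local_cov g f v eta y = 0.
    rewrite /local_cov eta0 // (christoffel0r gU _ (fU Uy)) addr0.
    rewrite (@near_eq_derive _ _ _ _ (cst 0)) ?derive_cst //.
    by apply: filterS (open_near oU Uy) => z /eta0.
  by rewrite /normal_part /tangent_part !mul0mx subrr.
apply: (orthogonal_hyperplane_eq0 nk (pg Uy) fJ eta0 (etaN y Uy)).
  exact/normal_part_orthogonal_mx/gramJ_unit.
have gC := bilinC _ _ (pg Uy).1.
have : 'D_v (fun z => bilin (g (f z)) (eta z) (eta z)) y = 0.
  rewrite (@near_eq_derive _ _ _ _ (cst a)) ?derive_cst //.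
  by apply: filterS (open_near oU Uy) => z /etaA.
rewrite local_cov_metric // (gC (eta y)) => cov0.
(* The tangential part is orthogonal to [eta y], so the normal part has the same inner product with
   it as the full derivative. *)
rewrite /normal_part bilinDl -scaleN1r bilinZl (gC (tangent_part _ _ _)).
rewrite /tangent_part bilin_mulr etaN // mul0mx mxE mulr0 addr0.
by move: cov0; lra.
Qed.

End Immersion.

End LocalGeometry.

(** * Composition with an umbilical immersion *)

Section Composite.
Context {R : realType}.
Variables (k n p : nat).
Variables (US : set 'rV[R]_k) (hS : 'rV[R]_k -> 'M[R]_k).
Variables (UN : set 'rV[R]_n) (gN : 'rV[R]_n -> 'M[R]_n).
Variables (UM : set 'rV[R]_p) (gM : 'rV[R]_p -> 'M[R]_p).
Variables (f : 'rV[R]_k -> 'rV[R]_n) (F : 'rV[R]_n -> 'rV[R]_p).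
Variables (G : 'rV[R]_k -> 'rV[R]_p) (H : 'rV[R]_n -> 'rV[R]_p).
Hypothesis fI : local_immersion US hS UN gN f.
Hypothesis FI : local_immersion UN gN UM gM F.
Hypothesis GE : forall y, US y -> G y = F (f y).
Hypothesis H_diff : forall x, UN x -> differentiable H x.
Hypothesis H_normal : forall x, UN x -> H x *m gM (F x) *m ('J F x)^T = 0.
Hypothesis umbilical : forall x v w, UN x ->
  local_second_form gM F v w x = bilin (gN x) v w *: H x.

Let oS : open US. Proof. by case: fI => -[]. Qed.
Let gMU : gram_field UM gM. Proof. by case: FI. Qed.
Let gNU : gram_field UN gN. Proof. by case: FI. Qed.
Let hSU : gram_field US hS. Proof. by case: fI. Qed.
Let fU y : US y -> UN (f y). Proof. by case: fI => _ _ _ fI' /fI'[]. Qed.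
Let FU x : UN x -> UM (F x). Proof. by case: FI => _ _ _ FI' /FI'[]. Qed.
Let hSE y : US y -> hS y = 'J f y *m gN (f y) *m ('J f y)^T.
Proof. by case: fI => _ _ _ fI' /fI'[]. Qed.
Let gNE x : UN x -> gN x = 'J F x *m gM (F x) *m ('J F x)^T.
Proof. by case: FI => _ _ _ FI' /FI'[]. Qed.
Let df y : US y -> differentiable f y.
Proof. by case: fI => _ _ sf _; exact: smooth_differentiable. Qed.
Let dF x : UN x -> differentiable F x.
Proof. by case: FI => _ _ sF _; exact: smooth_differentiable. Qed.
Let dJF x : UN x -> differentiable (jacobian F) x.
Proof.
case: FI => -[oN _ _] _ sF _; exact/smooth_differentiable/smooth_jacobian.
Qed.
Let dJf y : US y -> differentiable (jacobian f) y.
Proof. by case: fI => _ _ sf _; exact/smooth_differentiable/smooth_jacobian. Qed.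
Let JG y : US y -> 'J G y = 'J f y *m 'J F (f y).
Proof.
move=> Uy; apply: jacobian_comp (df Uy) (dF (fU Uy)).
exact: filterS GE (open_near oS Uy).
Qed.
Let JfN_unit y : US y -> 'J f y *m gN (f y) *m ('J f y)^T \in unitmx.
Proof. by move=> Uy; rewrite -(hSE Uy); exact: (gram_in_unit hSU Uy). Qed.

(** The Gauss formula of the hypersurface, with the normal field [H] in the role of its mean
    curvature vector. *)
Lemma umbilical_cov v w x : UN x ->
  local_cov gM F v (fun z => w *m 'J F z) x =
  christoffel gN x v w *m 'J F x + bilin (gN x) v w *: H x.
Proof. by move=> Ux; rewrite (local_cov_gauss FI _ _ Ux) umbilical. Qed.

Lemma local_cov_comp_tangent v (xi : 'rV[R]_k -> 'rV[R]_n) y : US y ->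
  differentiable xi y ->
  local_cov gM G v (fun z => xi z *m 'J F (f z)) y =
  local_cov gN f v xi y *m 'J F (f y) +
  bilin (gN (f y)) (v *m 'J f y) (xi y) *: H (f y).
Proof.
move=> Uy dxi; have Ufy := fU Uy.
have dJFf := differentiable_comp (df Uy) (dJF Ufy).
rewrite /local_cov (derive_mulmx v dxi dJFf) (derive_comp v (df Uy) (dJF Ufy)).
rewrite (deriveEjacobian v (df Uy)) GE // JG // mulmxA.
(* In the second term of the product rule [xi] is frozen at [y]. With the Christoffel term it
   becomes the covariant derivative along [F] of the field with constant components [xi y], which
   [umbilical_cov] computes. *)
rewrite -(derive_mul_jacobian FI _ _ Ufy) -addrA.
have := umbilical_cov (v *m 'J f y) (xi y) Ufy; rewrite /local_cov => ->.
by rewrite addrA mulmxDl.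
Qed.

Lemma local_cov_comp v (eta : 'rV[R]_n -> 'rV[R]_p) y : US y ->
  differentiable eta (f y) ->
  local_cov gM G v (eta \o f) y = local_cov gM F (v *m 'J f y) eta (f y).
Proof.
move=> Uy deta; rewrite /local_cov (derive_comp v (df Uy) deta) GE // JG //.
by rewrite (deriveEjacobian v (df Uy)) mulmxA.
Qed.

Lemma normal_part_comp_tangent xi y : US y ->
  normal_part (gM (G y)) ('J G y) (xi *m 'J F (f y)) =
  normal_part (gN (f y)) ('J f y) xi *m 'J F (f y).
Proof.
move=> Uy; rewrite GE // JG //; apply: normal_part_comp.
by rewrite -gNE //; exact: fU.
Qed.

Lemma normal_part_comp_normal y : US y ->
  normal_part (gM (G y)) ('J G y) (H (f y)) = H (f y).
Proof.
move=> Uy; apply: normal_part_id.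
by rewrite GE // JG // trmx_mul mulmxA H_normal ?mul0mx //; exact: fU.
Qed.

(** This is the normal part of [local_cov_comp_tangent] for the field [w *m 'J f z]: the term
    tangent to the hypersurface projects as it does there, and [H] is already normal. *)
Lemma local_second_form_comp v w y : US y ->
  local_second_form gM G v w y =
  local_second_form gN f v w y *m 'J F (f y) + bilin (hS y) v w *: H (f y).
Proof.
move=> Uy.
have dwJ : differentiable (fun z => w *m 'J f z) y.
  by apply: differentiable_mulmx; [exact: differentiable_cst|exact: dJf].
have E : \forall z \near y, w *m 'J G z = w *m 'J f z *m 'J F (f z).
  by apply: filterS (open_near oS Uy) => z Uz; rewrite JG // mulmxA.
rewrite /local_second_form.
have -> : local_cov gM G v (fun z => w *m 'J G z) y =
          local_cov gM G v (fun z => w *m 'J f z *m 'J F (f z)) y.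
  by rewrite /local_cov (near_eq_derive _ E) (nbhs_singleton E).
rewrite local_cov_comp_tangent // normal_partD normal_partZ.
rewrite normal_part_comp_tangent // normal_part_comp_normal //.
by rewrite bilin_mul -hSE.
Qed.

Lemma local_mean_curvature_comp y : (0 < k)%N -> US y ->
  local_mean_curvature hS gM G y =
  local_mean_curvature hS gN f y *m 'J F (f y) + H (f y).
Proof.
move=> k0 Uy; have k0' : k%:R != 0 :> R by rewrite pnatr_eq0 -lt0n.
rewrite /local_mean_curvature -scalemxAl mulmx_suml.
(* The trace of the metric with respect to itself is the dimension; symmetry of [hS] makes the
   double sum the trace of a matrix product. It cancels the factor [k%:R^-1], which is a true
   inverse because [k] is positive. *)
have tr1 : \sum_i \sum_j invmx (hS y) i j * hS y i j = k%:R.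
  rewrite -(mxtrace1 R k) -(mulVmx (gram_in_unit hSU Uy)).
  apply: eq_bigr => i _; rewrite mxE; apply: eq_bigr => j _.
  congr (_ * _).
  by rewrite -[in LHS](nbhs_singleton (gram_near_sym hSU Uy)) mxE.
have -> : H (f y) = k%:R^-1 *:
    ((\sum_i \sum_j invmx (hS y) i j * hS y i j) *: H (f y)).
  by rewrite tr1 scalerA mulVf // scale1r.
rewrite -scalerDr; congr (_ *: _); rewrite scaler_suml -big_split.
apply: eq_bigr => i _ /=.
rewrite mulmx_suml scaler_suml -big_split; apply: eq_bigr => j _ /=.
by rewrite local_second_form_comp // scalerDr -scalemxAl bilin_delta scalerA.
Qed.

Hypotheses (k0 : (0 < k)%N) (nk : n = k.+1) (pn : p = n.+1).
Variables (a b : R).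
Hypothesis f_cmc : forall y, US y ->
  bilin (gN (f y)) (local_mean_curvature hS gN f y)
                   (local_mean_curvature hS gN f y) = a.
Hypothesis H_length : forall x, UN x -> bilin (gM (F x)) (H x) (H x) = b.

(** The Weingarten equation. The normal part vanishes because [H] has constant length in codimension
    one; the tangential part comes from differentiating the orthogonality of [H] to the fields dF
    e_i. *)
Lemma umbilical_weingarten v x : UN x ->
  local_cov gM F v H x = (- b *: v) *m 'J F x.
Proof.
move=> Ux; have dH := H_diff Ux.
have pgM : posdef (gM (F x)) by case: gMU => _ _; apply; exact: FU.
have := constant_length_normal_parallel FI v pn Ux dH H_normal H_length.
rewrite /normal_part => /subr0_eq ->; rewrite /tangent_part; congr (_ *m _).
(* Multiplying by [gN x] reduces the claim to covectors, compared on each basis vector. *)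
rewrite -(gNE Ux); apply: (can_inj (mulmxK (gram_in_unit gNU Ux))).
rewrite mulmxKV ?(gram_in_unit gNU Ux) //; apply/rowP => i.
have dwJ : differentiable (fun z => delta_mx 0 i *m 'J F z : 'rV_p) x.
  by apply: differentiable_mulmx; [exact: differentiable_cst|exact: dJF].
have : 'D_v (fun z => bilin (gM (F z)) (H z) (delta_mx 0 i *m 'J F z)) x = 0.
  rewrite (@near_eq_derive _ _ _ _ (cst 0)) ?derive_cst //.
  have oN : open UN by case: gNU.
  apply: filterS (open_near oN Ux) => z Uz.
  by rewrite bilin_mulr H_normal // mul0mx mxE.
rewrite (local_cov_metric FI v Ux dH dwJ) (umbilical_cov _ _ Ux).
have HJ u : bilin (gM (F x)) (H x) (u *m 'J F x) = 0.
  by rewrite bilin_mulr H_normal // mul0mx mxE.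
rewrite bilinDr bilinZr H_length // HJ add0r bilin_mulr.
have coordE q (u : 'rV[R]_q) j : (u *m (delta_mx 0 j : 'rV_q)^T) 0 0 = u 0 j.
  by rewrite trmx_delta -colE mxE.
rewrite coordE => /eqP; rewrite addr_eq0 => /eqP ->.
by rewrite -scalemxAl [RHS]mxE -coordE -/(bilin _ _ _) mulrC mulNr.
Qed.

Theorem local_mean_curvature_parallel v y : US y ->
  normal_part (gM (G y)) ('J G y)
    (local_cov gM G v (local_mean_curvature hS gM G) y) = 0.
Proof.
move=> Uy; have Ufy := fU Uy.
set Hf := local_mean_curvature hS gN f.
have dHf : differentiable Hf y := local_mean_curvature_diff fI Uy.
have HfN z : US z -> Hf z *m gN (f z) *m ('J f z)^T = 0.
  exact: (local_mean_curvature_normal fI).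
pose T z := Hf z *m 'J F (f z).
have dT : differentiable T y.
  apply: differentiable_mulmx dHf _.
  exact: (differentiable_comp (df Uy) (dJF Ufy)).
have dHF : differentiable (H \o f) y.
  exact: (differentiable_comp (df Uy) (H_diff Ufy)).
have E : \forall z \near y, local_mean_curvature hS gM G z = (T + (H \o f)) z.
  by apply: filterS (open_near oS Uy) => z; exact: local_mean_curvature_comp.
have UMG : UM (G y) by rewrite GE //; exact: FU.
have -> : local_cov gM G v (local_mean_curvature hS gM G) y =
          local_cov gM G v T y + local_cov gM G v (H \o f) y.
  rewrite /local_cov (near_eq_derive _ E) (nbhs_singleton E).
  rewrite deriveD; [|exact: diff_derivable|exact: diff_derivable].
  by rewrite (christoffelDr gMU _ _ _ UMG) addrACA.
(* The derivative is now the image under dF of nabla_v H_f, plus a multiple of [H] that vanishes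
   because H_f is normal to the surface, plus [- b] times the pushforward of [v], which is tangent
   to the surface. *)
rewrite local_cov_comp_tangent // (local_cov_comp _ Uy (H_diff Ufy)).
rewrite umbilical_weingarten //.
have -> : bilin (gN (f y)) (v *m 'J f y) (Hf y) = 0.
  have pgN : posdef (gN (f y)) by case: gNU => _ _; exact.
  by rewrite (bilinC _ _ pgN.1) bilin_mulr HfN // mul0mx mxE.
rewrite scale0r addr0 normal_partD !normal_part_comp_tangent //.
rewrite (constant_length_normal_parallel fI v nk Uy dHf HfN f_cmc) mul0mx add0r.
by rewrite normal_partZ normal_part_tangent ?scaler0 ?mul0mx //; exact: JfN_unit.
Qed.

End Composite.

(** * Manifolds *)

Section Charts.
Context {R : realType}.

Lemma smooth_on_sub (V W : normedModType R) (U U' : set V) (f : V -> W) :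
  U `<=` U' -> smooth_on U' f -> smooth_on U f.
Proof. by move=> UU' sf j; apply: Ck_on_local => x /UU' U'x; exists U'. Qed.

Lemma loc_dom_open k n (S T : topologicalType) (f : S -> T) (c : chart R k S)
    (d : chart R n T) : continuous f -> open (loc_dom f c d).
Proof.
move=> cf; rewrite openE => y [cy dfy].
have cfc : {for y, continuous (f \o cinv c)}.
  by apply: continuous_comp; [exact: cinv_continuous|exact: cf].
apply: filterI (open_near (@cimg_open _ _ _ c) cy) _.
exact: cfc (open_near (@cdom_open _ _ _ d) dfy).
Qed.

Lemma metric_posdef n (Q : riemannian R n) c x :
  atlas Q c -> cimg c x -> posdef (metric Q c x).
Proof. by move=> Qc cx; split=> [|v]; [exact: Defs.metric_sym|exact: metric_pos]. Qed.

Lemma metric_gram_field n (Q : riemannian R n) c (U : set 'rV[R]_n) :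
  atlas Q c -> open U -> U `<=` cimg c -> gram_field U (metric Q c).
Proof.
move=> Qc oU Uc; split=> //; last by move=> x /Uc; exact: metric_posdef.
exact: smooth_on_sub Uc (metric_smooth Qc).
Qed.

(** The domains [U] and [U'] may be shrunk, so that an immersion can be restricted to where a
    composite is also defined in the charts. *)
Lemma isometric_local_immersion k n (S : riemannian R k) (Q : riemannian R n)
    (f : S -> Q) c d (U : set 'rV[R]_k) (U' : set 'rV[R]_n) :
  isometric_immersion f -> atlas S c -> atlas Q d ->
  open U -> U `<=` loc_dom f c d -> open U' -> U' `<=` cimg d ->
  (forall y, U y -> U' (loc f c d y)) ->
  local_immersion U (metric S c) U' (metric Q d) (loc f c d).
Proof.
move=> [[_ sf] isof] Sc Qd oU Uf oU' U'd fU; split.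
- by apply: metric_gram_field => // y /Uf[].
- exact: metric_gram_field.
- exact: smooth_on_sub Uf (sf _ _ Sc Qd).
- by move=> y Uy; have [] := isof c d Sc Qd y (Uf y Uy); split=> //; exact: fU.
Qed.

(** Squared lengths are differentiable, unlike the square root at zero. Squaring undoes [Num.sqrt]
    because the metric is nonnegative on every vector. *)
Lemma constant_mean_curvature_sqr k n (S : riemannian R k) (Q : riemannian R n)
    (f : S -> Q) : constant_mean_curvature f ->
  exists a : R, forall c d, atlas S c -> atlas Q d -> forall y,
    loc_dom f c d y ->
    bilin (metric Q d (loc f c d y)) (mean_curvature f c d y)
          (mean_curvature f c d y) = a.
Proof.
move=> [h hf]; exists (h ^+ 2) => c d Sc Qd y yf.
rewrite -(hf c d Sc Qd y yf) sqr_sqrtr //.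
have [cy dy] := yf; have [H0|H0] := eqVneq (mean_curvature f c d y) 0.
  by rewrite H0 bilin0l.
exact/ltW/metric_pos/H0/cmap_img.
Qed.

End Charts.

(** * Composition of isometric immersions *)

Section Composition.
Context {R : realType} {k n p : nat}.
Variables (S : riemannian R k) (N : riemannian R n) (M : riemannian R p).
Variables (phi : S -> N) (iota : N -> M).
Hypotheses (phiI : isometric_immersion phi) (iotaI : isometric_immersion iota).
Let psi (x : S) : M := iota (phi x).

Let cphi : continuous phi. Proof. by case: phiI => -[]. Qed.
Let ciota : continuous iota. Proof. by case: iotaI => -[]. Qed.
Let cpsi : continuous psi.
Proof. by move=> x; apply: continuous_comp; [exact: cphi|exact: ciota]. Qed.

Section InCharts.
Variables (c : chart R k S) (e : chart R n N) (d : chart R p M).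
Hypotheses (Sc : atlas S c) (Ne : atlas N e) (Md : atlas M d).
(** The part of the chart [c] that [phi] sends into [e] and the composite sends into [d]; there the
    expression of the composite factors through [e]. *)
Let US := loc_dom phi c e `&` loc_dom psi c d.
Let UN := loc_dom iota e d.

Lemma comp_dom_open : open US.
Proof. by apply: openI; exact: loc_dom_open. Qed.

Lemma loc_comp y : US y -> loc psi c d y = loc iota e d (loc phi c e y).
Proof. by move=> [[_ ey] _]; rewrite /loc cmapK. Qed.

Lemma loc_comp_dom y : US y -> UN (loc phi c e y).
Proof.
by move=> [[_ ey] [_ dy]]; split; [exact: cmap_img|rewrite /loc cmapK].
Qed.

Lemma local_immersion_inner :
  local_immersion US (metric S c) UN (metric N e) (loc phi c e).
Proof.
apply: isometric_local_immersion => //.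
- exact: comp_dom_open.
- by move=> y [].
- exact: loc_dom_open.
- by move=> x [].
- exact: loc_comp_dom.
Qed.

Lemma local_immersion_outer :
  local_immersion UN (metric N e) (cimg d) (metric M d) (loc iota e d).
Proof.
apply: isometric_local_immersion => //.
- exact: loc_dom_open.
- exact: cimg_open.
- by move=> x [_ dx]; exact: cmap_img.
Qed.

End InCharts.

Lemma isometric_immersion_comp : isometric_immersion psi.
Proof.
(* Every point of the domain of the composite has an intermediate chart around its image under
   [phi]; smoothness and the metric identity are then checked there. *)
have chart_at (c : chart R k S) (d : chart R p M) y : loc_dom psi c d y ->
    exists2 e, atlas N e & (loc_dom phi c e `&` loc_dom psi c d) y.
  move=> yd; have [e Ne ey] := atlas_cover (phi (cinv c y)); exists e => //.
  by split=> //; split=> //; case: yd.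
split=> [|c d Sc Md y yd].
  split=> // c d Sc Md j; apply: Ck_on_local => y /chart_at[e Ne yU].
  exists (loc_dom phi c e `&` loc_dom psi c d) => //.
  have [_ _ sf fI] := local_immersion_inner d Sc Ne.
  have [_ _ sF _] := local_immersion_outer Ne Md.
  have oU : open (loc_dom phi c e `&` loc_dom psi c d).
    exact: comp_dom_open.
  apply: (@Ck_on_eq _ _ _ _ _ (loc iota e d \o loc phi c e)) => //.
    by move=> z zU; rewrite /= -loc_comp.
  by apply: Ck_on_comp (sf j) (sF j) => // z /fI[].
have [e Ne yU] := chart_at c d y yd.
have [_ _ sf fI] := local_immersion_inner d Sc Ne.
have [_ _ sF FI] := local_immersion_outer Ne Md.
have [Uy fJ SE] := fI _ yU; have [_ FJ NE] := FI _ Uy.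
have -> : 'J (loc psi c d) y =
    'J (loc phi c e) y *m 'J (loc iota e d) (loc phi c e y).
  apply: jacobian_comp.
  - have oU : open (loc_dom phi c e `&` loc_dom psi c d).
      exact: comp_dom_open.
    by apply: filterS (open_near oU yU) => z; exact: loc_comp.
  - exact: smooth_differentiable sf yU.
  - exact: smooth_differentiable sF Uy.
split=> /=; first by rewrite /row_free mxrankMfree // (eqP fJ).
by rewrite SE NE (loc_comp yU) trmx_mul !mulmxA.
Qed.

End Composition.

Theorem proposition3p1 (R : realType)
  (M : riemannian R 4) (N : riemannian R 3) (Sigma : riemannian R 2)
  (iota : N -> M) (phi : Sigma -> N) :
  orientable M ->
  isometric_immersion iota ->
  totally_umbilical iota ->
  constant_mean_curvature iota ->
  orientable Sigma ->
  isometric_immersion phi ->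
  constant_mean_curvature phi ->
  parallel_mean_curvature_immersion (fun x : Sigma => iota (phi x)) \/
  minimal_immersion (fun x : Sigma => iota (phi x)).
Proof.
move=> _ iotaI umb /constant_mean_curvature_sqr[b Hb] _ phiI.
move=> /constant_mean_curvature_sqr[a Ha].
have psiI := isometric_immersion_comp phiI iotaI.
(* The mean curvature vector of the composite is parallel in any case; whether it vanishes
   identically decides which alternative is claimed. *)
have [min|nmin] := EM (zero_mean_curvature (fun x => iota (phi x))).
  by right.
left; split=> // c d Sc Md y yd v.
have [e Ne ey] := atlas_cover (phi (cinv c y)).
have fI := local_immersion_inner phiI iotaI d Sc Ne.
have FI := local_immersion_outer iotaI Ne Md.
have yU : (loc_dom phi c e `&` loc_dom (fun x => iota (phi x)) c d) y.
  by split=> //; split=> //; case: yd.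
(* The claim at [y] is local, so one intermediate chart [e] suffices. Here [a] and [b] are the
   squared lengths of the mean curvature vectors of [phi] and [iota]. *)
apply: (local_mean_curvature_parallel (H := mean_curvature iota e d) fI FI
  _ _ _ _ _ _ _ (a := a) _ (b := b) _ v yU) => //.
- by move=> z; exact: loc_comp.
- by move=> x; exact: (local_mean_curvature_diff FI).
- by move=> x; exact: (local_mean_curvature_normal FI).
- by move=> x v' w' Ux; exact: umb.
- by move=> z [zU _]; exact: Ha.
- by move=> x Ux; exact: Hb.
Qed.
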